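(* Let $g_1,\dots,g_n$ be a finite family of isometries of a metric space $X$ (onto itself). Then for every $\varepsilon>0$ and every finite collection $x_1,\dots,x_m$ of elements of $X$ there exist a finite metric space $\widetilde X$, elements $\tilde x_1,\dots,\tilde x_m$ of $\widetilde X$, and isometries $\tilde g_1,\dots,\tilde g_n$ of $\widetilde X$ (onto itself) such that the indexed metric spaces $\{g_i\cdot x_j : i=1,\dots,n,\ j=1,\dots,m\}$ and $\{\tilde g_i\cdot\tilde x_j : i=1,\dots,n,\ j=1,\dots,m\}$, both naturally indexed by $\{1,\dots,n\}\times\{1,\dots,m\}$, are $\varepsilon$-isometric.
   Context: A metric space $X$ is indexed by a set $I$ if a surjection $f_X\colon I\to X$ is given. Two metric spaces $X$ and $Y$ indexed by the same set $I$ (via $f_X$ and $f_Y$) are $\varepsilon$-isometric if for all $i,j\in I$ the distances $d_X(f_X(i),f_X(j))$ and $d_Y(f_Y(i),f_Y(j))$ differ by at most $\varepsilon$. Here the index $(i,j)$ is sent to $g_i\cdot x_j=g_i(x_j)$, respectively to $\tilde g_i\cdot\tilde x_j=\tilde g_i(\tilde x_j)$. *)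

(* Defs.v *)
From HB Require Import structures.
From mathcomp Require Import all_boot all_order all_algebra.
From mathcomp Require Import boolp classical_sets functions cardinality reals.
From mathcomp Require Import topology metric_structure.

Set Implicit Arguments.
Unset Strict Implicit.
Unset Printing Implicit Defensive.

Import Order.TTheory GRing.Theory Num.Theory.

Local Open Scope classical_set_scope.
Local Open Scope ring_scope.

Definition onto_isometry (R : realType) (X : metricType R) (g : X -> X) : Prop :=
  (forall x y, mdist (g x) (g y) = mdist x y) /\ set_surj [set: X] [set: X] g.

(* A fresh alias of [set_type A], so that the induced metric below does not
   interfere with any other structure on [set_type A]. *)
Definition metric_sub (R : realType) (X : metricType R) (A : set X) : Type :=
  set_type A.

Section metric_sub.
Context {R : realType} {X : metricType R} (A : set X).

HB.instance Definition _ := Choice.on (metric_sub A).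

Definition sub_dist (u v : metric_sub A) : R := mdist (\val u) (\val v).

Lemma sub_distxx u : sub_dist u u = 0.
Proof. exact: mdistxx. Qed.

Lemma sub_dist_positivity u v : sub_dist u v = 0 -> u = v.
Proof. by move=> /mdist_positivity /val_inj. Qed.

Lemma sub_dist_sym u v : sub_dist u v = sub_dist v u.
Proof. exact: metric_sym. Qed.

Lemma sub_dist_triangle v u w : sub_dist u w <= sub_dist u v + sub_dist v w.
Proof. exact: metric_triangle. Qed.

HB.instance Definition _ := isMetric.Build R (metric_sub A)
  sub_distxx sub_dist_positivity sub_dist_sym sub_dist_triangle.

End metric_sub.

Record indexed_metric (R : realType) (I : Type) := IndexedMetric {
  im_space :> metricType R ;
  im_index : I -> im_space ;
  im_surj : set_surj [set: I] [set: im_space] im_index }.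

Definition eps_isometric (R : realType) (I : Type) (eps : R)
    (X Y : indexed_metric R I) : Prop :=
  forall i j : I,
    `|mdist (im_index X i) (im_index X j)
      - mdist (im_index Y i) (im_index Y j)| <= eps.

Section indexed_range.
Context {R : realType} {X : metricType R} {I : Type} (f : I -> X).

Definition range_index (i : I) : metric_sub (range f) :=
  exist _ (f i) (mem_set (imageT f i)).

Lemma range_index_surj :
  set_surj [set: I] [set: metric_sub (range f)] range_index.
Proof.
move=> [y yf] _; have [i _ fi] := set_mem yf.
by exists i => //; apply: val_inj.
Qed.

(* The subspace {f i : i in I} of X, indexed by I via i |-> f i. *)
Definition indexed_range : indexed_metric R I := IndexedMetric range_index_surj.

End indexed_range.

(* Main.v *)
Require Import Defs.
From HB Require Import structures.
From mathcomp Require Import all_boot all_order all_algebra all_fingroup.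
From mathcomp Require Import boolp classical_sets functions cardinality reals.
From mathcomp Require Import topology metric_structure.
From mathcomp Require Import lra zify.

Import Order.TTheory GRing.Theory Num.Theory.
Local Open Scope classical_set_scope.
Local Open Scope ring_scope.

(** The space [Y] is [G * 'I_m] for a finite group [G] containing elements
[a i], the isometry [h i] is left multiplication by [a i], and [y j] is
[(1, j)].  The metric copies the distances of [X] along words in the
generators: from [(s, j)] to [(t, l)] it takes the infimum, over all words [w]
with [s * w(a) = t], of [mdist (x j) (w(g) (x l)) + delta * size w], capped by
a large constant [M].  Concatenation and inversion of words give the triangle
inequality and symmetry, and left invariance is built in, so this is a
pseudometric for which the [h i] are isometries; adding [delta] to all
distances of distinct points makes it a metric.

The word [a_i^-1 a_k] shows that the distance from [(a i, j)] to [(a k, l)] is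
at most [mdist (g i (x j)) (g k (x l)) + 2 delta], which is
[word_dist_gen_le].  For the converse bound [word_dist_gen_ge], a word of
length more than [M / delta] costs at least [M], so only short words [w] with
[a_i w(a) = a_k] matter.  If the word [a_i w a_k^-1] is trivial in the free
group, then [g_i] composed with [w(g)] is [g_k], and the cost of [w] is at
least the wanted distance.  So [G] must be such that every short word trivial
in [G] is trivial in the free group.  Such a [G] exists because free groups are
residually finite ([free_group_residually_finite]): let the generators act on
a disjoint union of paths, one for each short reduced word, so that reading
the word moves along its whole path; being reduced says precisely that each
generator acts on the paths by a partial injection, and a partial injection of
a finite set extends to a permutation. *)

(** * Residual finiteness of free groups *)

Section residual_finiteness.
Local Set Implicit Arguments.
Local Unset Strict Implicit.

Local Open Scope nat_scope.
Local Open Scope group_scope.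

(** A permutation that is already right at the earlier points is corrected at a
new point [x] by a transposition of [p x] and [f x]; injectivity of [f] keeps
both these values away from the earlier ones. *)
Lemma partial_injection_extend (T : finType) (D : {set T}) (f : T -> T) :
  {in D &, injective f} -> exists p : {perm T}, {in D, p =1 f}.
Proof.
move=> fI.
have [p pE] : exists p : {perm T}, {in enum D, p =1 f}.
  have {fI} : {in enum D &, injective f}.
    by move=> x y; rewrite !mem_enum; exact: fI.
  elim: (enum D) (enum_uniq D) => [|x s IHs] /=; first by exists 1.
  case/andP=> xs s_uniq fI.
  have [y z ys zs|p pE] := IHs s_uniq.
    by apply: fI; rewrite inE ?ys ?zs orbT.
  exists (p * tperm (p x) (f x)) => y; rewrite inE permM => /predU1P[->|ys].
    by rewrite tpermL.
  have yNx : x != y by apply: contraNneq xs => ->.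
  rewrite tpermD ?(inj_eq perm_inj) ?pE //.
  by apply: contra_neq yNx; apply: fI; rewrite inE ?eqxx ?ys ?orbT.
by exists p => x xD; apply: pE; rewrite mem_enum.
Qed.

Variable I : finType.
Implicit Types (i : I) (l : I * bool) (u v w : seq (I * bool)).

(** The letter [(i, true)] stands for the generator [i] and [(i, false)] for its
inverse. *)
Definition letter_inv l := (l.1, ~~ l.2).

Definition reduced := sorted (fun l l' => l' != letter_inv l).

(** The words equal to [1] in the free group on [I].  The inductive form lets a
property of such words be proved by inserting one cancelling pair at a time,
without constructing the free group. *)
Inductive freely_trivial : seq (I * bool) -> Prop :=
| freely_trivial_nil : freely_trivial [::]
| freely_trivial_insert u l v :
    freely_trivial (u ++ v) -> freely_trivial (u ++ [:: l, letter_inv l & v]).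

Definition word_eval (G : finGroupType) (a : I -> G) w : G :=
  \prod_(l <- w) (if l.2 then a l.1 else (a l.1)^-1).

Lemma not_reduced w :
  ~~ reduced w -> exists u l v, w = u ++ [:: l, letter_inv l & v].
Proof.
elim: w => // l [|l' w] // IH /=.
rewrite negb_and negbK => /orP[/eqP ->|/IH [u [l0 [v ->]]]].
  by exists [::], l, w.
by exists (l :: u), l0, v.
Qed.

Lemma word_eval_cancel (G : finGroupType) (a : I -> G) u l v :
  word_eval a (u ++ [:: l, letter_inv l & v]) = word_eval a (u ++ v).
Proof.
rewrite /word_eval !big_cat !big_cons /=; congr (_ * _).
by case: l => i [] /=; rewrite ?mulKVg ?mulKg.
Qed.

(** Removing a cancelling pair does not change the value of a word and shortens
it, so nontriviality in [G] need be known for reduced words only. *)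
Lemma separating_reduced_trivial (G : finGroupType) (a : I -> G) L :
  (forall w, size w <= L -> reduced w -> word_eval a w = 1 -> w = [::]) ->
  forall w, size w <= L -> word_eval a w = 1 -> freely_trivial w.
Proof.
move=> sep w; have [k] := ubnP (size w); elim: k w => // k IHk w wk wL w1.
have [wr|/not_reduced [u [l [v wE]]]] := boolP (reduced w).
  by rewrite (sep w); [exact: freely_trivial_nil | | |].
move: wk wL w1; rewrite wE word_eval_cancel !size_cat /= => wk wL w1.
by apply/freely_trivial_insert/IHk => //; rewrite size_cat; lia.
Qed.

Section path_permutations.
Variable L : nat.
Let T : Type := (L.-bseq (I * bool) * 'I_L.+1)%type.
Implicit Type p : T.

(** A point [(w, k)] of [T] is the [k]-th vertex of the path labelled by the
word [w], whose edge from [k] to [k + 1] carries the letter number [k] of [w].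
The generator [i] crosses forward the edges labelled [(i, true)] and backward
those labelled [(i, false)].  The default letter [(i, true)] is never met: it is
excluded by the size test in [forward] and by the sign in [backward]. *)
Definition forward i p :=
  (p.2 < size p.1) && (nth (i, true) p.1 p.2 == (i, true)).
Definition backward i p :=
  (0 < p.2) && (nth (i, true) p.1 p.2.-1 == (i, false)).
Definition step i p : T :=
  (p.1, inord (if forward i p then p.2.+1 else p.2.-1)).
Definition step_dom i :=
  [set p : T | reduced p.1 & forward i p || backward i p].

Lemma reduced_nth x0 w k : reduced w -> k.+1 < size w ->
  nth x0 w k.+1 != letter_inv (nth x0 w k).
Proof. by move=> /(sortedP x0); apply. Qed.

Lemma stepE i p :
  (step i p).2 = (if forward i p then p.2.+1 else p.2.-1) :> nat.
Proof.
rewrite inordK //; have := size_bseq p.1; have := ltn_ord p.2.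
by case: ifP => [/andP[+ _]|_]; lia.
Qed.

Lemma backward_size i p : backward i p -> p.2.-1 < size p.1.
Proof.
case/andP=> _ /eqP e; rewrite ltnNge; apply/negP => /(nth_default (i, true)).
by rewrite e.
Qed.

(** If two vertices have the same image, one of them lies just before it and
the other just after it; the two letters around the image are then inverse to
each other, which a reduced word forbids. *)
Lemma step_inj i : {in step_dom i &, injective (step i)}.
Proof.
move=> p q pD qD e.
have e2 : (step i p).2 = (step i q).2 :> nat by rewrite e.
move: e2; rewrite !stepE.
case: p q pD qD e => [w k] [w' k'] pD qD [eww _].
rewrite -{}eww in qD *; move: pD qD; rewrite !inE /=.
case/andP=> wr pD /andP[_ qD] e; congr (_, _); apply/val_inj => /=.
have red := @reduced_nth (i, true) w _ wr.
move: pD qD e; case: ifP => [/andP[/= k1 /eqP k2] _|_ /=].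
  case: ifP => [/andP[/= k1' k2'] _|_ /= B]; first lia.
  have /= S := backward_size B.
  case/andP: B => /= k0' /eqP k2' kk; move: S k2'; rewrite -kk => /red.
  by rewrite k2 => /eqP N /N.
move=> B; have /= S := backward_size B; case/andP: B => /= k0 /eqP k2.
case: ifP => [/andP[/= k1' /eqP k2'] _ kk|_ /= /andP[/= k0' k2'] kk]; last lia.
by move: S k2; rewrite kk => /red; rewrite k2' => /eqP N /N.
Qed.

(** Reading a reduced word [w] moves the vertex [0] of its own path to the vertex
[size w]. *)
Lemma path_group_separates : exists a : I -> {perm T},
  forall w, size w <= L -> reduced w -> word_eval a w = 1 -> w = [::].
Proof.
have /fin_all_exists [a aE] i := partial_injection_extend (@step_inj i).
exists a => w wL wr w1; have [//|w0] := eqVneq w [::].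
pose at_ k : T := (Bseq wL, inord k).
have at2 k : k <= size w -> (at_ k).2 = k :> nat.
  by move=> kw; rewrite /= inordK // ltnS (leq_trans kw).
have walk k : k <= size w -> word_eval a (take k w) (at_ 0) = at_ k.
  elim: k => [_|k IHk kw]; first by rewrite take0 /word_eval big_nil perm1.
  have atk := at2 _ (ltnW kw); have atk1 := at2 _ kw.
  have [l0 _] : exists l : I * bool, l \in w.
    by case: (w) kw => // l w' _; exists l; rewrite inE eqxx.
  rewrite (take_nth l0) // /word_eval big_rcons permM {}IHk 1?ltnW //.
  case wk : (nth l0 w k) => [i []] /=.
    have F : forward i (at_ k).
      by rewrite /forward atk /= kw (set_nth_default l0) // wk eqxx.
    by rewrite aE ?inE ?F ?wr // /step F atk.
  (* An inverse letter is read by stepping back from the vertex k + 1; that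
     vertex is not left forward, since the next letter is not [(i, true)]. *)
  have B : backward i (at_ k.+1).
    by rewrite /backward atk1 /= (set_nth_default l0) // wk eqxx.
  have NF : forward i (at_ k.+1) = false.
    apply/negP; rewrite /forward atk1 => /andP[/= kw1].
    have := reduced_nth (i, true) wr kw1.
    by rewrite (set_nth_default l0 (i, true) kw) wk => /negPf ->.
  apply: (can_inj (permK (a i))).
  by rewrite permKV aE ?inE ?B ?wr ?orbT // /step NF atk1.
have := walk _ (leqnn _); rewrite take_size w1 perm1 => /(congr1 (fun p => p.2 : nat)).
by rewrite !at2 // => /esym/size0nil.
Qed.
End path_permutations.
Lemma word_eval_cat (G : finGroupType) (a : I -> G) u v :
  word_eval a (u ++ v) = word_eval a u * word_eval a v.
Proof. exact: big_cat. Qed.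

Definition word_inv w := rev (map letter_inv w).

Lemma word_invK : involutive word_inv.
Proof.
move=> w; rewrite /word_inv map_rev revK -map_comp map_id_in // => -[i b] _.
by rewrite /letter_inv /= negbK.
Qed.

Lemma word_eval_inv (G : finGroupType) (a : I -> G) w :
  word_eval a (word_inv w) = (word_eval a w)^-1.
Proof.
elim: w => [|l w IHw]; first by rewrite /word_eval !big_nil invg1.
rewrite /word_inv /= rev_cons -cats1 word_eval_cat -/(word_inv w) IHw.
rewrite -(cat1s l w) word_eval_cat invMg; congr (_ * _).
by rewrite /word_eval !big_seq1; case: l => i [] //=; rewrite invgK.
Qed.

(** Residual finiteness of the free group on [I], in a uniform form: one finite
quotient detects all the nontrivial elements of length at most [L]. *)
Lemma free_group_residually_finite L :
  exists (G : finGroupType) (a : I -> G),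
    forall w, size w <= L -> word_eval a w = 1 -> freely_trivial w.
Proof.
have [a aP] := path_group_separates L.
by exists {perm L.-bseq (I * bool) * 'I_L.+1}, a; exact: separating_reduced_trivial.
Qed.

End residual_finiteness.

(** * Words acting on a set *)

Section word_action.
Local Set Implicit Arguments.
Local Unset Strict Implicit.
Variables (I : finType) (X : Type) (f : I * bool -> X -> X).
Hypothesis fK : forall l, cancel (f (letter_inv l)) (f l).

Definition word_act (w : seq (I * bool)) (z : X) : X := foldr f z w.

Lemma word_act_cat u v z : word_act (u ++ v) z = word_act u (word_act v z).
Proof. exact: foldr_cat. Qed.

(** This links [G] to [X]: a relation that holds in the free group holds between
any family of bijections. *)
Lemma word_act_freely_trivial w z : freely_trivial w -> word_act w z = z.
Proof.
elim=> {w} // u l v _ IHuv; rewrite -[RHS]IHuv.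
by rewrite !word_act_cat; congr (word_act u _); apply: fK.
Qed.

Lemma word_act_invK w : cancel (word_act (word_inv w)) (word_act w).
Proof.
elim: w => //= l w IHw z.
by rewrite /word_inv /= rev_cons -cats1 word_act_cat IHw; apply: fK.
Qed.

End word_action.

(** * The word metric on G * J *)

Section word_metric.
Local Set Implicit Arguments.
Local Unset Strict Implicit.
Variables (R : realType) (X : metricType R) (I J : finType) (G : finGroupType).
Variables (a : I -> G) (f : I * bool -> X -> X) (x : J -> X) (delta M : R).
Hypothesis fK : forall l, cancel (f (letter_inv l)) (f l).
Hypothesis f_isom : forall l y z, mdist (f l y) (f l z) = mdist y z.
Hypotheses (delta_gt0 : 0 < delta) (M_ge0 : 0 <= M).
Implicit Types (u v : G * J) (w : seq (I * bool)).

Lemma word_act_isom w y z :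
  mdist (word_act f w y) (word_act f w z) = mdist y z.
Proof. by elim: w => //= l w IHw; rewrite f_isom. Qed.

Definition cost u v w : R :=
  mdist (x u.2) (word_act f w (x v.2)) + delta *+ size w.

(** The cap [M] makes the infimum meaningful also between points that no word
connects, the [a i] not being required to generate [G]. *)
Definition costs u v : set R :=
  [set r | r = M \/ exists2 w, v.1 = (u.1 * word_eval a w)%g & r = cost u v w].

Definition word_dist u v : R := inf (costs u v).

Lemma cost_ge0 u v w : 0 <= cost u v w.
Proof. by rewrite addr_ge0 ?mdist_ge0 // mulrn_wge0 // ltW. Qed.

Lemma costs_lbound u v : lbound (costs u v) 0.
Proof. by move=> r [->//|[w _ ->]]; exact: cost_ge0. Qed.

Lemma word_dist_ge0 u v : 0 <= word_dist u v.
Proof. by apply: lb_le_inf; [exists M; left | exact: costs_lbound]. Qed.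

Lemma word_dist_le u v r : costs u v r -> word_dist u v <= r.
Proof. by apply: ge_inf; exists 0; exact: costs_lbound. Qed.

Lemma le_word_dist u v b : (forall r, costs u v r -> b <= r) -> b <= word_dist u v.
Proof. by apply: lb_le_inf; exists M; left. Qed.

Lemma word_dist_self u : word_dist u u = 0.
Proof.
apply/eqP; rewrite eq_le word_dist_ge0 andbT; apply: word_dist_le; right.
by exists [::]; rewrite ?/word_eval ?big_nil ?mulg1 // /cost /= mdistxx addr0.
Qed.

Lemma word_dist_sym u v : word_dist u v = word_dist v u.
Proof.
suff le_uv u' v' : word_dist u' v' <= word_dist v' u'.
  by apply/eqP; rewrite eq_le !le_uv.
apply: le_word_dist => r [->|[w uvw ->]]; apply: word_dist_le; first by left.
right; exists (word_inv w); first by rewrite uvw word_eval_inv mulgK.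
rewrite /cost size_rev size_map; congr (_ + _).
by rewrite -[RHS](word_act_isom w) (word_act_invK fK) metric_sym.
Qed.

(** The charges [delta *+ size w] add up under concatenation, and so do the
distances in [X] up to the triangle inequality, [w1] being an isometry. *)
Lemma word_dist_triangle v u t : word_dist u t <= word_dist u v + word_dist v t.
Proof.
rewrite -lerBlDr; apply: le_word_dist => r uvr.
rewrite lerBlDr -lerBlDl; apply: le_word_dist => s vts; rewrite lerBlDl.
have r0 := costs_lbound uvr; have s0 := costs_lbound vts.
case: uvr r0 => [-> _|[w1 vE ->] r0].
  by apply: (le_trans (word_dist_le (or_introl erefl))); rewrite lerDl.
case: vts s0 => [-> _|[w2 tE ->] s0].
  by apply: (le_trans (word_dist_le (or_introl erefl))); rewrite lerDr.
apply: le_trans (word_dist_le (or_intror _)) _.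
  by exists (w1 ++ w2) => //; rewrite tE vE word_eval_cat mulgA.
rewrite /cost word_act_cat size_cat mulrnDr addrACA lerD2r.
by rewrite -(word_act_isom w1 (x v.2)) metric_triangle.
Qed.

Lemma word_dist_mull (h : G) u v :
  word_dist ((h * u.1)%g, u.2) ((h * v.1)%g, v.2) = word_dist u v.
Proof.
congr inf; apply/seteqP; split=> r [->|[w /= vE ->]]; try by left.
  by right; exists w => //; apply: (mulgI h); rewrite vE mulgA.
by right; exists w => //=; rewrite vE mulgA.
Qed.

Lemma word_dist_gen_le i k j l :
  word_dist (a i, j) (a k, l)
    <= mdist (f (i, true) (x j)) (f (k, true) (x l)) + delta *+ 2.
Proof.
apply: word_dist_le; right; exists [:: (i, false); (k, true)].
  by rewrite /word_eval !big_cons big_nil /= mulg1 mulKVg.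
rewrite /cost /= -(f_isom (i, false)); congr (mdist _ _ + _).
exact: (fK (i, false)).
Qed.

(** Words longer than [N] cost more than the cap; the shorter ones produce, with
the letters [i] and [k] at their ends, words of length at most [N.+2] that are
trivial in [G], hence relations in [X]. *)
Lemma word_dist_gen_ge (N : nat) i k j l :
  (forall w, (size w <= N.+2)%N -> word_eval a w = 1%g -> freely_trivial w) ->
  mdist (f (i, true) (x j)) (f (k, true) (x l)) <= M ->
  M <= delta *+ N ->
  mdist (f (i, true) (x j)) (f (k, true) (x l)) <= word_dist (a i, j) (a k, l).
Proof.
move=> aP DM MN; apply: le_word_dist => r [->//|[w /= akE ->]].
have [wN|Nw] := leqP (size w) N; last first.
  apply: (le_trans DM); apply: (le_trans MN).
  by rewrite (le_trans (ler_wpMn2l (ltW delta_gt0) (ltnW Nw))) // lerDr mdist_ge0.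
have : freely_trivial ((i, true) :: w ++ [:: (k, false)]).
  apply: aP; first by rewrite /= size_cat addn1 !ltnS.
  rewrite -cat1s !word_eval_cat /word_eval !big_seq1 /= mulgA -akE.
  exact: mulgV.
move=> /(word_act_freely_trivial fK (f (k, true) (x l))).
rewrite -cat1s !word_act_cat /= (fK (k, false)) => <-.
by rewrite f_isom lerDl mulrn_wge0 // ltW.
Qed.

(** [word_dist] vanishes between [(s, j)] and [(s, l)] when [x j = x l], so
distinct points are pushed apart by [delta]. *)
Definition separated_dist u v : R := word_dist u v + delta * (u != v)%:R.

Lemma separated_distxx u : separated_dist u u = 0.
Proof. by rewrite /separated_dist word_dist_self eqxx mulr0 addr0. Qed.

Lemma separated_dist_eq0 u v : separated_dist u v = 0 -> u = v.
Proof.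
have [//|uv] := eqVneq u v; rewrite /separated_dist uv mulr1 => /eqP.
by rewrite gt_eqF // ltr_wpDl // word_dist_ge0.
Qed.

Lemma separated_dist_sym u v : separated_dist u v = separated_dist v u.
Proof. by rewrite /separated_dist word_dist_sym eq_sym. Qed.

Lemma separated_dist_triangle v u t :
  separated_dist u t <= separated_dist u v + separated_dist v t.
Proof.
rewrite /separated_dist addrACA -mulrDr lerD ?word_dist_triangle //.
rewrite ler_pM2l // -natrD ler_nat.
have [->|_] := eqVneq u v; first by rewrite add0n.
by rewrite (leq_trans (leq_b1 _)).
Qed.

Definition word_space : metricType R := HB.pack (G * J)%type
  (@isMetric.Build R (G * J)%type separated_dist
    separated_distxx separated_dist_eq0 separated_dist_sym separated_dist_triangle).

End word_metric.

Lemma onto_isometry_inverse {R : realType} {X : metricType R} {g : X -> X} :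
  onto_isometry g -> exists h, cancel h g /\ cancel g h.
Proof.
case=> gd gs; have /choice[h hK] z : exists y, g y = z.
  by have [y _ <-] := gs z Logic.I; exists y.
exists h; split=> // y; apply: mdist_positivity.
by rewrite -gd hK mdistxx.
Qed.

Theorem theorem3p2 (R : realType) (X : metricType R) (n : nat)
    (g : 'I_n -> X -> X) (g_isom : forall i, onto_isometry (g i))
    (eps : R) (eps_gt0 : 0 < eps) (m : nat) (x : 'I_m -> X) :
  exists (Y : metricType R) (y : 'I_m -> Y) (h : 'I_n -> Y -> Y),
    [/\ finite_set [set: Y],
        forall i, onto_isometry (h i)
      & eps_isometric eps
          (indexed_range (fun ij : 'I_n * 'I_m => g ij.1 (x ij.2)))
          (indexed_range (fun ij : 'I_n * 'I_m => h ij.1 (y ij.2)))].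
Proof.
have /fin_all_exists[ginv ginvP] i := onto_isometry_inverse (g_isom i).
pose f (l : 'I_n * bool) := if l.2 then g l.1 else ginv l.1.
have fK l : cancel (f (letter_inv l)) (f l).
  by case: l => i []; have [gK Kg] := ginvP i; [exact: gK | exact: Kg].
have f_isom l y z : mdist (f l y) (f l z) = mdist y z.
  case: l => i b; have [gd _] := g_isom i; have [gK _] := ginvP i.
  by case: b; rewrite /f /= ?gd // -gd !gK.
pose D (p q : 'I_n * 'I_m) := mdist (g p.1 (x p.2)) (g q.1 (x q.2)).
pose M := \sum_(pq : ('I_n * 'I_m) * ('I_n * 'I_m)) D pq.1 pq.2.
have D_M p q : D p q <= M.
  by rewrite /M (bigD1 (p, q)) //= lerDl sumr_ge0 // => *; exact: mdist_ge0.
have M_ge0 : 0 <= M by apply: sumr_ge0 => *; exact: mdist_ge0.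
(* Each distance is exceeded by at most 2 delta for the word of length 2 and
   delta for the separation of points. *)
pose delta := eps / 3.
have delta_gt0 : 0 < delta by rewrite divr_gt0.
pose N := Num.bound (M / delta).
have M_N : M <= delta *+ N.
  rewrite -mulr_natr -ler_pdivrMl // mulrC ltW // archi_boundP //.
  by rewrite divr_ge0 // ltW.
have [G [a aP]] := free_group_residually_finite 'I_n N.+2.
pose Y := word_space a x fK f_isom delta_gt0 M_ge0.
exists Y, (fun j => (1%g, j) : Y), (fun i u => ((a i * u.1)%g, u.2) : Y).
split.
- exact: (@finite_finset (G * 'I_m)%type).
- move=> i; split=> [u v|u _].
    rewrite /mdist /= /separated_dist word_dist_mull.
    congr (_ + delta * (~~ _)%:R).
    by rewrite !xpair_eqE (inj_eq (mulgI _)).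
  exists ((a i)^-1 * u.1, u.2)%g => //=.
  by rewrite mulKVg; case: u.
- move=> [i j] [k l].
  have le_D := D_M (i, j) (k, l).
  have ge := word_dist_gen_ge fK f_isom delta_gt0 aP le_D M_N.
  have le := word_dist_gen_le a x fK f_isom delta_gt0 M_ge0 i k j l.
  change (`|D (i, j) (k, l) - separated_dist a f x delta M
      ((a i * 1)%g, j) ((a k * 1)%g, l)| <= eps).
  have b01 : 0 <= delta * ((a i, j) != (a k, l))%:R <= delta.
    have d0 := ltW delta_gt0.
    by case: (_ != _); rewrite /= ?mulr0 ?mulr1 lexx d0.
  rewrite /separated_dist !mulg1 ler_norml.
  have : delta *+ 3 = eps by rewrite -mulr_natr divfK ?pnatr_eq0.
  have : eps > 0 by [].
  move: ge le b01; rewrite [f (i, true)]/f [f (k, true)]/f /= -/(D (i, j) (k, l)).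
  lra.
Qed.
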